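(* For $p\in(0,1]$ consider the initial value problem for real functions $\varphi_1,\varphi_2$ of $y\in\mathbb{R}$: $$\varphi_1''=(1-2\varphi_1^2-8\varphi_2^2)\varphi_1,\qquad \varphi_2''=(4-2\varphi_1^2-8\varphi_2^2)\varphi_2,$$ $$\varphi_1(0)=0,\quad \varphi_2(0)=p,\quad \varphi_1'(0)=2p,\quad \varphi_2'(0)=0.$$ There exists only one periodic solution $(\varphi_1,\varphi_2)$ of this problem (as $p$ ranges over $(0,1]$) such that $\varphi_1$ has exactly two zeros in a period and $\varphi_2$ is positive everywhere. It corresponds to the initial value $\varphi_2(0)=p=\sqrt{3/8}$.
   Context: A solution $(\varphi_1,\varphi_2)$ is called periodic if the pair is periodic in $y$; ''in a period'' means in a half-open interval $[y_0,y_0+T)$ where $T>0$ is the least common period of the pair $(\varphi_1,\varphi_2)$. *)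

(* Defs.v *)
From Stdlib Require Import Reals.
From Coquelicot Require Import Coquelicot.

Local Open Scope R_scope.

(* [Derive] is total, so the existence of the first derivatives is required
   separately from the second-order equations. *)
Definition ivp_solution (p : R) (phi1 phi2 : R -> R) : Prop :=
  (forall y, ex_derive phi1 y) /\
  (forall y, ex_derive phi2 y) /\
  (forall y, is_derive (Derive phi1) y
               ((1 - 2 * phi1 y ^ 2 - 8 * phi2 y ^ 2) * phi1 y)) /\
  (forall y, is_derive (Derive phi2) y
               ((4 - 2 * phi1 y ^ 2 - 8 * phi2 y ^ 2) * phi2 y)) /\
  phi1 0 = 0 /\ phi2 0 = p /\ Derive phi1 0 = 2 * p /\ Derive phi2 0 = 0.

Definition common_period (phi1 phi2 : R -> R) (T : R) : Prop :=
  0 < T /\ forall y, phi1 (y + T) = phi1 y /\ phi2 (y + T) = phi2 y.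

Definition periodic_pair (phi1 phi2 : R -> R) : Prop :=
  exists T, common_period phi1 phi2 T.

Definition least_common_period (phi1 phi2 : R -> R) (T : R) : Prop :=
  common_period phi1 phi2 T /\
  forall S, common_period phi1 phi2 S -> T <= S.

Definition exactly_two_zeros_in (f : R -> R) (a b : R) : Prop :=
  exists z1 z2, z1 <> z2 /\
    forall z, (a <= z < b /\ f z = 0) <-> (z = z1 \/ z = z2).

(* The count does not depend on the chosen interval [y0, y0 + T). *)
Definition two_zeros_in_a_period (phi1 phi2 : R -> R) : Prop :=
  exists T, least_common_period phi1 phi2 T /\
    forall y0, exactly_two_zeros_in phi1 y0 (y0 + T).

Definition admissible_solution (p : R) (phi1 phi2 : R -> R) : Prop :=
  0 < p <= 1 /\
  ivp_solution p phi1 phi2 /\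
  periodic_pair phi1 phi2 /\
  two_zeros_in_a_period phi1 phi2 /\
  (forall y, 0 < phi2 y).

(* Main.v *)
Require Import Defs.
From Stdlib Require Import Reals Lra Lia Psatz Classical.
From Coquelicot Require Import Coquelicot.

Local Open Scope R_scope.

(** Put [u = phi1], [v = 2 phi2], [r = u^2 + v^2] and [a = 4 p^2].  The system
becomes [u'' = (1 - 2r) u], [v'' = (4 - 2r) v], an integrable system (two
components of the Garnier system), and the initial data select the level
[a (3 - a) / 3], [-4 a (3 - a) / 3] of its two first integrals.

For a number [l] let [P_l = (l - 1)(l - 4) + (l - 4) u^2 + (l - 1) v^2].  The
first integrals give [2 P P'' - P'^2 = 4 (l - 2r) P^2 - 4 c(l) (l - 1)(l - 4)]
with [c(l) = l (l - 1 - a)(l - 4 + a)].  So for the two parameters [l = 1 + a]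
and [l = 4 - a] the function [sqrt |P_l|] solves, where it does not vanish, the linear
equation [x'' = (l - 2r) x], which [u] and [v] solve for [l = 1] and [l = 4].
Everything rests on comparing these four solutions of one Schroedinger equation.

The two parameters coincide exactly when [a = 3/2], that is [p = sqrt (3/8)].
Then [P_(5/2)] vanishes identically: the solution lies on the hyperbola
[v^2 - u^2 = 3/2] and is [u = sin g / sqrt 2], [v = sqrt (3 + sin^2 g) / sqrt 2]
with [g' = sqrt (3 + sin^2 g)], which gives existence
([admissible_solution_exists]).

If [a >= 3], a positive periodic [v] is impossible: at its minimum [v' = 0] and
[v'' >= 0], and this contradicts the values of the first integrals
([no_periodic_positive_above]).

Let [0 < a < 3], [a <> 3/2], and suppose that the solution is admissible with
period [T]; let [h = T / 2].  As [u] is odd and [v] even, [u] vanishes at [0] and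
[h] only in [[0, T)], and [v' (h) = 0].  Write [x2] and [x1] for the solutions with
[l = 4 - a] and [l = 1 + a].  As [x2] vanishes at [0] like [u] and [4 - a > 1], it
oscillates more slowly than [u] and has no zero in [(0, h]] ([gap_positive]).  The
first integrals leave only two values for [v (h)^2], namely [a], where [x2] would
vanish, and [3 - a], where [x1] vanishes.  In the second case reflection in [h / 2]
exchanges [a] with [3 - a] and [x2] with [x1], so [x1 > 0] on [[0, h)].  Then
[x1 x2 / v^2] and [u / v] both vanish at [0] and [h], and, since
[(1 + a) + (4 - a) - 8 = 1 - 4], they solve the same Sturm-Liouville equation up to
the term [2 v^2 (x1 / v)' (x2 / v)'], which is negative.  Their Wronskian would be
strictly monotone and zero at both ends ([no_half_period]).

This leaves [a = 3/2], where the solution is determined by its initial data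
([manakov_unique]). *)

(** * The system and its first integrals *)

(** The derivatives are carried as separate functions, so that [u y], [du y],
[v y], [dv y] are the coordinates of a point moving in phase space. *)
Definition manakov (u du v dv : R -> R) : Prop :=
  forall y, is_derive u y (du y) /\
    is_derive du y ((1 - 2 * (u y ^ 2 + v y ^ 2)) * u y) /\
    is_derive v y (dv y) /\
    is_derive dv y ((4 - 2 * (u y ^ 2 + v y ^ 2)) * v y).

Definition integral_u (u du v dv : R) : R :=
  du ^ 2 - u ^ 2 + u ^ 2 * (u ^ 2 + v ^ 2) - (u * dv - v * du) ^ 2 / 3.

Definition integral_v (u du v dv : R) : R :=
  dv ^ 2 - 4 * v ^ 2 + v ^ 2 * (u ^ 2 + v ^ 2) + (u * dv - v * du) ^ 2 / 3.

Definition on_level (a : R) (u du v dv : R -> R) : Prop :=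
  forall y, integral_u (u y) (du y) (v y) (dv y) = a * (3 - a) / 3 /\
    integral_v (u y) (du y) (v y) (dv y) = - 4 * a * (3 - a) / 3.

(** [auto_derive] expresses the derivative of an unknown function by [Derive]; the
hypotheses give its value. *)
Ltac known_derivatives :=
  repeat match goal with
  | H : is_derive ?f ?y ?l |- context [Derive (fun x => ?f x) ?z] =>
      replace (Derive (fun x => f x) z) with l
        by (symmetry; exact (is_derive_unique f z l H))
  end.

Ltac differentiate :=
  auto_derive;
  [ repeat split; try (eexists; eassumption); auto
  | known_derivatives ].

Lemma zero_derivative_constant (f : R -> R) :
  (forall y, is_derive f y 0) -> forall y, f y = f 0.
Proof.
  intros H y.
  destruct (MVT_gen f 0 y (fun _ => 0)) as [c [_ Hc]].
  - intros; apply H.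
  - intros x _. apply continuity_pt_filterlim.
    apply (ex_derive_continuous f). eexists; apply H.
  - lra.
Qed.

Lemma integral_u_constant u du v dv : manakov u du v dv ->
  forall y, integral_u (u y) (du y) (v y) (dv y) = integral_u (u 0) (du 0) (v 0) (dv 0).
Proof.
  intros H.
  apply (zero_derivative_constant (fun y => integral_u (u y) (du y) (v y) (dv y))).
  intro y; simpl in y; destruct (H y) as (Hu & Hdu & Hv & Hdv). unfold integral_u.
  differentiate. field.
Qed.

Lemma integral_v_constant u du v dv : manakov u du v dv ->
  forall y, integral_v (u y) (du y) (v y) (dv y) = integral_v (u 0) (du 0) (v 0) (dv 0).
Proof.
  intros H.
  apply (zero_derivative_constant (fun y => integral_v (u y) (du y) (v y) (dv y))).
  intro y; simpl in y; destruct (H y) as (Hu & Hdu & Hv & Hdv). unfold integral_v.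
  differentiate. field.
Qed.

(** Only the squares are prescribed, so that the motion reflected in the middle of a
half period, which may start with [du] of either sign, is covered too. *)
Definition starts_at (a : R) (u du v dv : R -> R) : Prop :=
  u 0 = 0 /\ du 0 ^ 2 = a /\ v 0 ^ 2 = a /\ dv 0 = 0.

Lemma start_on_level a u du v dv :
  manakov u du v dv -> starts_at a u du v dv -> on_level a u du v dv.
Proof.
  intros H (H0 & H1 & H2 & H3) y.
  rewrite (integral_u_constant _ _ _ _ H y), (integral_v_constant _ _ _ _ H y).
  unfold integral_u, integral_v. rewrite H0, H3.
  replace ((0 * 0 - v 0 * du 0) ^ 2) with (v 0 ^ 2 * du 0 ^ 2) by ring.
  rewrite H1, H2. split; [field|].
  replace (v 0 ^ 2 * (0 ^ 2 + a)) with (a * a) by (rewrite H2; ring). field.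
Qed.

Definition bounded_by_5 (u v : R -> R) : Prop :=
  forall y, u y ^ 2 + v y ^ 2 <= 5.

(** The sum of the two first integrals is the energy [u'^2 + v'^2 - u^2 - 4 v^2 + r^2],
here [-a (3 - a) <= 4], so [r^2 <= 4 r + 4].  This makes the vector field
Lipschitz along every solution considered. *)
Lemma level_bounded a u du v dv : 0 < a <= 4 -> on_level a u du v dv ->
  bounded_by_5 u v.
Proof.
  intros Ha H y. destruct (H y) as [H1 H2]. unfold integral_u, integral_v in *.
  pose proof (pow2_ge_0 (du y)). pose proof (pow2_ge_0 (dv y)).
  pose proof (pow2_ge_0 (u y)). pose proof (pow2_ge_0 (v y)).
  nra.
Qed.

Lemma reflect_manakov h u du v dv : manakov u du v dv ->
  manakov (fun y => u (h - y)) (fun y => - du (h - y))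
          (fun y => v (h - y)) (fun y => - dv (h - y)).
Proof.
  intros H y. destruct (H (h - y)) as (Hu & Hdu & Hv & Hdv).
  split; [|split; [|split]]; cbv beta; auto_derive.
  all: try (unfold Rminus in *; eexists; eassumption).
  all: known_derivatives; ring.
Qed.

Lemma negate_manakov u du v dv : manakov u du v dv ->
  manakov (fun y => - u y) (fun y => - du y) v dv.
Proof.
  intros H y. destruct (H y) as (Hu & Hdu & Hv & Hdv).
  split; [|split; [|split]]; cbv beta.
  1,2: differentiate; ring.
  - exact Hv.
  - replace ((- u y) ^ 2) with (u y ^ 2) by ring. exact Hdv.
Qed.

(** * Real-variable tools *)

Lemma strictly_decreasing (f df : R -> R) s t : s < t ->
  (forall y, s <= y <= t -> is_derive f y (df y)) ->
  (forall y, s < y < t -> df y < 0) -> f t < f s.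
Proof.
  intros st Hf Hdf.
  destruct (MVT_cor2 f df s t st) as [c [E Hc]].
  - intros y Hy. apply is_derive_Reals, Hf, Hy.
  - specialize (Hdf c Hc). nra.
Qed.

Lemma continuity_eps (f : R -> R) x : ex_derive f x ->
  forall eps, 0 < eps -> exists del, 0 < del /\
    forall y, Rabs (y - x) < del -> Rabs (f y - f x) < eps.
Proof.
  intros H eps Heps.
  assert (C : continuous f x) by (apply (ex_derive_continuous f); exact H).
  destruct (C (fun z => Rabs (z - f x) < eps)) as [d Hd].
  - exists (mkposreal eps Heps). intros z Hz; exact Hz.
  - exists d; split; [apply cond_pos|]. intros y Hy. apply (Hd y Hy).
Qed.

Lemma positive_right_of_zero (f : R -> R) (l : R) : is_derive f 0 l -> 0 < l -> f 0 = 0 ->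
  exists del, 0 < del /\ forall y, 0 < y < del -> 0 < f y.
Proof.
  intros H Hl H0.
  apply is_derive_Reals in H. destruct (H (l / 2)) as [d Hd]; [lra|].
  exists d; split; [apply cond_pos|]. intros y Hy.
  specialize (Hd y). rewrite Rplus_0_l, H0 in Hd.
  assert (A : Rabs ((f y - 0) / y - l) < l / 2).
  { apply Hd; [lra|]. rewrite Rabs_pos_eq; lra. }
  apply Rabs_def2 in A.
  assert (B : 0 < (f y - 0) / y) by lra.
  replace (f y) with ((f y - 0) / y * y) by (field; lra).
  apply Rmult_lt_0_compat; lra.
Qed.

Lemma positive_or_first_zero (f : R -> R) h del : (forall y, ex_derive f y) ->
  0 < del -> (forall y, 0 < y < del -> 0 < f y) ->
  (forall y, 0 < y <= h -> 0 < f y) \/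
  exists z, 0 < z <= h /\ f z = 0 /\ forall y, 0 < y < z -> 0 < f y.
Proof.
  intros Hf Hdel Hpos.
  destruct (classic (forall y, 0 < y <= h -> 0 < f y)) as [A|A];
    [left; exact A|right].
  apply not_all_ex_not in A. destruct A as [b Hb].
  apply imply_to_and in Hb. destruct Hb as [Hbh Hb].
  set (E := fun t => 0 <= t <= b /\ forall y, 0 < y < t -> 0 < f y).
  destruct (completeness E) as [z [Hub Hlub]].
  { exists b. intros t [Ht _]; lra. }
  { exists 0. split; [lra|]. intros; lra. }
  assert (Hdb : del <= b) by (apply Rnot_lt_le; intros C; apply Hb, Hpos; lra).
  assert (Hz : del <= z).
  { apply Hub. split; [lra|exact Hpos]. }
  assert (Hzb : z <= b) by (apply Hlub; intros t [Ht _]; lra).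
  assert (Hbelow : forall y, 0 < y < z -> 0 < f y).
  { intros y Hy. apply Rnot_le_lt; intros C.
    assert (z <= y); [|lra]. apply Hlub. intros t [Ht Hft].
    apply Rnot_lt_le; intros D. specialize (Hft y). lra. }
  exists z. split; [lra|]. split; [|exact Hbelow].
  apply Rle_antisym; apply Rnot_lt_le; intros C.
  - destruct (continuity_eps f z (Hf z) (f z) C) as [d [Hd Hnear]].
    assert (z < b) by (destruct Hzb as [|e]; [assumption|subst; lra]).
    assert (E (Rmin (z + d / 2) b)).
    { pose proof (Rmin_l (z + d / 2) b). pose proof (Rmin_r (z + d / 2) b).
      split; [split; [apply Rmin_glb; lra|lra]|].
      intros y Hy. destruct (Rlt_le_dec y z); [apply Hbelow; lra|].
      specialize (Hnear y). rewrite Rabs_pos_eq in Hnear by lra.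
      assert (K : Rabs (f y - f z) < f z) by (apply Hnear; lra).
      apply Rabs_def2 in K; lra. }
    assert (Rmin (z + d / 2) b <= z) by (apply Hub; assumption).
    assert (z < Rmin (z + d / 2) b) by (apply Rmin_glb_lt; lra). lra.
  - destruct (continuity_eps f z (Hf z) (- f z)) as [d [Hd Hnear]]; [lra|].
    pose (y := Rmax (z / 2) (z - d / 2)).
    assert (Hy : z / 2 <= y /\ z - d / 2 <= y) by (split; [apply Rmax_l|apply Rmax_r]).
    assert (y < z) by (apply Rmax_lub_lt; lra).
    assert (K : Rabs (f y - f z) < - f z).
    { apply Hnear. rewrite Rabs_left; lra. }
    apply Rabs_def2 in K. specialize (Hbelow y). lra.
Qed.

(** This and the next lemma let a Wronskian tend to zero at an endpoint where one of
its factors is a square root vanishing there: [f] need not even be defined at the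
endpoint, as only the smooth bound [K] on its square is evaluated there. *)
Lemma negative_of_decreasing (f K : R -> R) (z : R) :
  (forall s t, 0 < s -> s < t -> t < z -> f t < f s) ->
  (forall y, 0 < y < z -> f y ^ 2 <= K y) ->
  ex_derive K 0 -> K 0 = 0 -> forall y, 0 < y < z -> f y < 0.
Proof.
  intros Hdec HK HdK K0 y Hy. apply Rnot_le_lt; intros C.
  assert (A : 0 < f (y / 2)) by (specialize (Hdec (y / 2) y); lra).
  destruct (continuity_eps K 0 HdK (f (y / 2) ^ 2)) as [d [Hd Hnear]].
  { apply pow_lt; lra. }
  pose (t := Rmin (y / 4) (d / 2)).
  assert (Ht : t <= y / 4 /\ t <= d / 2) by (split; [apply Rmin_l|apply Rmin_r]).
  assert (0 < t) by (apply Rmin_glb_lt; lra).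
  assert (B : Rabs (K t - K 0) < f (y / 2) ^ 2).
  { apply Hnear. rewrite Rabs_pos_eq; lra. }
  apply Rabs_def2 in B. rewrite K0 in B.
  assert (f (y / 2) < f t) by (apply Hdec; lra).
  assert (f t ^ 2 <= K t) by (apply HK; lra). nra.
Qed.

Lemma positive_of_decreasing (f K : R -> R) (z : R) :
  (forall s t, 0 < s -> s < t -> t < z -> f t < f s) ->
  (forall y, 0 < y < z -> f y ^ 2 <= K y) ->
  ex_derive K z -> K z = 0 -> forall y, 0 < y < z -> 0 < f y.
Proof.
  intros Hdec HK HdK Kz y Hy.
  assert (A : - f (z - (z - y)) < 0).
  { apply (negative_of_decreasing (fun y => - f (z - y)) (fun y => K (z - y)) z).
    - intros s t Hs st Ht. specialize (Hdec (z - t) (z - s)). lra.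
    - intros t Ht. specialize (HK (z - t)).
      replace ((- f (z - t)) ^ 2) with (f (z - t) ^ 2) by ring. apply HK; lra.
    - assert (HdK' : ex_derive K (z - 0)) by (rewrite Rminus_0_r; exact HdK).
      auto_derive. exact HdK'.
    - rewrite Rminus_0_r; exact Kz.
    - lra. }
  replace (z - (z - y)) with y in A by ring. lra.
Qed.

(** * Square roots of quadratic forms that solve linear equations *)

(** This is [(3 - 2a) P_(4 - a)], and [gap (3 - a)] is [(3 - 2 (3 - a)) P_(1 + a)].
The constant factor only adjusts the sign: [P_(4 - a)] changes sign when [a]
crosses [3/2], and with this factor the form is nonnegative along the motion. *)
Definition gap (a u v : R) : R :=
  (3 - 2 * a) * ((3 - a) * v ^ 2 - a * u ^ 2 - a * (3 - a)).

Definition dgap (a u du v dv : R) : R :=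
  (3 - 2 * a) * (2 * (3 - a) * v * dv - 2 * a * u * du).
(** The square of the derivative of [sqrt gap], written as a polynomial so that it
makes sense where [gap] vanishes; it is [gap'' / 2 - (4 - a - 2r) gap]. *)
Definition dsqrtgap_sqr (a u du v dv : R) : R :=
  (3 - 2 * a) * ((3 - a) * (dv ^ 2 + (4 - 2 * (u ^ 2 + v ^ 2)) * v ^ 2)
    - a * (du ^ 2 + (1 - 2 * (u ^ 2 + v ^ 2)) * u ^ 2))
  - (4 - a - 2 * (u ^ 2 + v ^ 2)) * gap a u v.

(** The two sides differ by a multiple of the characteristic polynomial of the level,
[l (l - 1 - a)(l - 4 + a)], evaluated at its root [4 - a]. *)
Lemma dgap_sqr a u du v dv :
  integral_u u du v dv = a * (3 - a) / 3 -> integral_v u du v dv = - 4 * a * (3 - a) / 3 ->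
  dgap a u du v dv ^ 2 = 4 * gap a u v * dsqrtgap_sqr a u du v dv.
Proof.
  intros H1 H2.
  assert (E : dgap a u du v dv ^ 2 - 4 * gap a u v * dsqrtgap_sqr a u du v dv =
    4 * (3 - 2 * a) ^ 2 * (3 - a) * (- a) *
    ((4 - a) * (3 - a) * (- a) + a * integral_u u du v dv - (3 - a) * integral_v u du v dv)).
  { unfold dgap, dsqrtgap_sqr, gap, integral_u, integral_v. field. }
  rewrite H1, H2 in E.
  apply Rminus_diag_uniq. rewrite E. field.
Qed.

Lemma is_derive_gap a u du v dv y : manakov u du v dv ->
  is_derive (fun y => gap a (u y) (v y)) y (dgap a (u y) (du y) (v y) (dv y)).
Proof.
  intros H. destruct (H y) as (Hu & Hdu & Hv & Hdv).
  unfold gap, dgap. differentiate. ring.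
Qed.

Definition edge a (u v : R -> R) y := sqrt (gap a (u y) (v y)).

Definition dedge a (u du v dv : R -> R) y :=
  dgap a (u y) (du y) (v y) (dv y) / (2 * edge a u v y).

(** The levels of [a] and [3 - a] are the same; this is why both [4 - a] and
[4 - (3 - a) = 1 + a] give solutions of linear equations along one motion. *)
Lemma level_symmetric a u du v dv :
  on_level a u du v dv -> on_level (3 - a) u du v dv.
Proof. intros L y. destruct (L y) as [-> ->]. split; field. Qed.

(** For [x = sqrt gap] the relation [gap'^2 = 4 gap (gap'' / 2 - (4 - a - 2r) gap)] is
exactly [x'' = (4 - a - 2r) x]. *)
Lemma edge_solves a u du v dv y :
  manakov u du v dv -> on_level a u du v dv -> 0 < gap a (u y) (v y) ->
  0 < edge a u v y /\
  edge a u v y ^ 2 = gap a (u y) (v y) /\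
  dedge a u du v dv y ^ 2 = dsqrtgap_sqr a (u y) (du y) (v y) (dv y) /\
  is_derive (edge a u v) y (dedge a u du v dv y) /\
  is_derive (dedge a u du v dv) y
    ((4 - a - 2 * (u y ^ 2 + v y ^ 2)) * edge a u v y).
Proof.
  intros H L Hpos.
  assert (Hp : 0 < edge a u v y) by (apply sqrt_lt_R0, Hpos).
  assert (Hs : edge a u v y ^ 2 = gap a (u y) (v y))
    by (unfold edge; apply pow2_sqrt; lra).
  assert (Hds : dedge a u du v dv y ^ 2 = dsqrtgap_sqr a (u y) (du y) (v y) (dv y)).
  { destruct (L y) as [L1 L2]. unfold dedge.
    rewrite Rdiv_def, Rpow_mult_distr, dgap_sqr, <- Hs by assumption.
    field. lra. }
  assert (He : is_derive (edge a u v) y (dedge a u du v dv y)).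
  { pose proof (is_derive_gap a u du v dv y H) as Hg.
    unfold edge. evar_last.
    - apply (is_derive_comp sqrt (fun y => gap a (u y) (v y))).
      + apply is_derive_sqrt; [apply is_derive_id|exact Hpos].
      + exact Hg.
    - unfold dedge, edge, scal; simpl. unfold mult, one; simpl. field.
      apply Rgt_not_eq, Hp. }
  do 4 (split; [assumption|]).
  destruct (H y) as (Hu & Hdu & Hv & Hdv).
  assert (Hd : is_derive (fun y => dgap a (u y) (du y) (v y) (dv y)) y
    (2 * (dsqrtgap_sqr a (u y) (du y) (v y) (dv y)
       + (4 - a - 2 * (u y ^ 2 + v y ^ 2)) * gap a (u y) (v y)))).
  { unfold dgap, dsqrtgap_sqr, gap. differentiate. ring. }
  evar_last.
  - unfold dedge. apply (is_derive_div (fun y => dgap a (u y) (du y) (v y) (dv y))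
      (fun y => 2 * edge a u v y)).
    + exact Hd.
    + apply is_derive_scal, He.
    + lra.
  - rewrite <- Hds, <- Hs.
    replace (dgap a (u y) (du y) (v y) (dv y))
      with (2 * edge a u v y * dedge a u du v dv y) by (unfold dedge; field; lra).
    field. lra.
Qed.

(** * Comparison with [u] on a half period *)

Lemma gap_at_start a u v : u 0 = 0 -> v 0 ^ 2 = a -> gap a (u 0) (v 0) = 0.
Proof. intros H0 H1. unfold gap. rewrite H0, H1. ring. Qed.

(** Sturm comparison.  Let [x = sqrt gap].  Both [x] and [u] vanish at [0], and their
Wronskian [x u' - x' u] has derivative [(a - 3) x u < 0].  So it is negative up to
the first zero [z] of [x]; if [z = h] it should also return to [0], and if [z < h]
then [x / u] would increase from a positive value to [0]. *)
Lemma gap_positive a u du v dv h :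
  0 < a < 3 -> a <> 3 / 2 -> manakov u du v dv -> starts_at a u du v dv ->
  (forall y, 0 < y < h -> 0 < u y) -> u h = 0 ->
  forall y, 0 < y <= h -> 0 < gap a (u y) (v y).
Proof.
  intros Ha Ha' H S Hu0 Huh.
  pose proof (start_on_level _ _ _ _ _ H S) as L.
  destruct S as (S0 & S1 & S2 & S3).
  assert (Hgap0 : gap a (u 0) (v 0) = 0) by (apply gap_at_start; assumption).
  assert (Hright : exists del, 0 < del /\
    forall y, 0 < y < del -> 0 < gap a (u y) (v y)).
  { destruct (positive_right_of_zero (fun y => dgap a (u y) (du y) (v y) (dv y))
      (2 * a * (3 - 2 * a) ^ 2 * (4 - a))) as [del [Hdel Hd]].
    - destruct (H 0) as (Hu & Hdu & Hv & Hdv). unfold dgap. differentiate.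
      rewrite S0, S3.
      transitivity ((3 - 2 * a) * (2 * (3 - a) * (4 - 2 * v 0 ^ 2) * v 0 ^ 2
        - 2 * a * du 0 ^ 2)); [ring|]. rewrite S1, S2. ring.
    - apply Rmult_lt_0_compat; [|lra]. apply Rmult_lt_0_compat; [lra|].
      apply pow2_gt_0; lra.
    - unfold dgap. rewrite S0, S3. ring.
    - exists del; split; [exact Hdel|]. intros y Hy.
      assert (K : - gap a (u y) (v y) < - gap a (u 0) (v 0)); [|lra].
      apply (strictly_decreasing (fun y => - gap a (u y) (v y))
        (fun y => - dgap a (u y) (du y) (v y) (dv y))); [lra| |].
      + intros x _. apply (is_derive_opp (fun y => gap a (u y) (v y))).
        apply is_derive_gap, H.
      + intros x Hx. specialize (Hd x). lra. }
  destruct Hright as [del [Hdel Hright]].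
  destruct (positive_or_first_zero (fun y => gap a (u y) (v y)) h del)
    as [A|[z (Hz & Hgz & Hbefore)]];
    [|exact Hdel|exact Hright|exact A|exfalso].
  { intros y. eexists. apply is_derive_gap, H. }
  pose (x := edge a u v). pose (dx := dedge a u du v dv).
  pose (f := fun y => x y * du y - dx y * u y).
  (* [f ^ 2 <= K] is [(p - q)^2 <= 2 (p^2 + q^2)], with the squares of [x] and [dx]
     replaced by polynomials. *)
  pose (K := fun y => 2 * (gap a (u y) (v y) * du y ^ 2
    + dsqrtgap_sqr a (u y) (du y) (v y) (dv y) * u y ^ 2)).
  assert (HK : forall y, ex_derive K y).
  { intros y. destruct (H y) as (Hu & Hdu & Hv & Hdv).
    unfold K, gap, dsqrtgap_sqr, gap. auto_derive.
    repeat split; eexists; eassumption. }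
  assert (Hfdec : forall s t, 0 < s -> s < t -> t < z -> f t < f s).
  { intros s t Hs st Ht.
    apply (strictly_decreasing f (fun y => (a - 3) * x y * u y)); [exact st| |].
    - intros y Hy. destruct (edge_solves a u du v dv y H L) as (_ & _ & _ & Hx & Hdx);
        [apply Hbefore; lra|]. fold x in Hx, Hdx. fold dx in Hx, Hdx.
      destruct (H y) as (Hu & Hdu & Hv & Hdv).
      unfold f. differentiate. ring.
    - intros y Hy. destruct (edge_solves a u du v dv y H L) as (Hx & _);
        [apply Hbefore; lra|]. fold x in Hx.
      assert (0 < x y * u y) by (apply Rmult_lt_0_compat; [exact Hx|apply Hu0; lra]).
      nra. }
  assert (HfK : forall y, 0 < y < z -> f y ^ 2 <= K y).
  { intros y Hy. destruct (edge_solves a u du v dv y H L) as (_ & Hs & Hds & _);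
      [apply Hbefore; lra|].
    unfold f, K. rewrite <- Hs, <- Hds. fold x dx.
    pose proof (pow2_ge_0 (x y * du y + dx y * u y)). nra. }
  assert (Hfneg : forall y, 0 < y < z -> f y < 0).
  { apply (negative_of_decreasing f K z Hfdec HfK (HK 0)).
    unfold K. rewrite Hgap0, S0. ring. }
  destruct (Req_dec z h) as [->|Hzh].
  - assert (Hfpos : forall y, 0 < y < h -> 0 < f y).
    { apply (positive_of_decreasing f K h Hfdec HfK (HK h)).
      unfold K. rewrite Hgz, Huh. ring. }
    specialize (Hfpos (h / 2)). specialize (Hfneg (h / 2)). lra.
  - assert (B : - (gap a (u z) (v z) / u z ^ 2) <
      - (gap a (u (z / 2)) (v (z / 2)) / u (z / 2) ^ 2)).
    { apply (strictly_decreasing (fun y => - (gap a (u y) (v y) / u y ^ 2))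
        (fun y => (2 * gap a (u y) (v y) * du y
          - dgap a (u y) (du y) (v y) (dv y) * u y) / u y ^ 3)); [lra| |].
      - intros y Hy. assert (Hy0 : 0 < u y) by (apply Hu0; lra).
        pose proof (is_derive_gap a u du v dv y H) as Hg.
        destruct (H y) as (Hu & _).
        assert (D : forall (g : R -> R) dg, is_derive g y dg ->
          is_derive (fun y => - (g y / u y ^ 2)) y
            ((2 * g y * du y - dg * u y) / u y ^ 3)).
        { intros g dg Hdg. differentiate; [apply Rgt_not_eq; nra|field; lra]. }
        exact (D _ _ Hg).
      - intros y Hy. assert (Hy0 : 0 < u y) by (apply Hu0; lra).
        destruct (edge_solves a u du v dv y H L) as (Hp & Hs & _ & _ & _);
          [apply Hbefore; lra|]. fold x in Hp, Hs.
        rewrite <- Hs.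
        replace (dgap a (u y) (du y) (v y) (dv y)) with (2 * x y * dx y)
          by (unfold dx, dedge; fold x; field; lra).
        replace (_ / _) with (2 * x y * f y / u y ^ 3) by (unfold f; field; lra).
        apply Rmult_neg_pos; [|apply Rinv_0_lt_compat, pow_lt, Hy0].
        specialize (Hfneg y). nra. }
    rewrite Hgz in B.
    assert (0 < gap a (u (z / 2)) (v (z / 2)) / u (z / 2) ^ 2).
    { apply Rdiv_lt_0_compat; [apply Hbefore; lra|]. apply pow_lt, Hu0; lra. }
    unfold Rdiv in B at 1. lra.
Qed.

(** With [V = v^2] and [D = u'^2], elimination between the two integrals leaves
[(V - 4)(V - D) = 0], where [V = 4] would make [D] negative, and then
[V (3 - V) = a (3 - a)]. *)
Lemma level_at_return a u du v dv h : 0 < a < 3 -> on_level a u du v dv ->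
  u h = 0 -> dv h = 0 ->
  du h ^ 2 = v h ^ 2 /\ (v h ^ 2 = a \/ v h ^ 2 = 3 - a).
Proof.
  intros Ha L H0 H3. destruct (L h) as [L1 L2]. unfold integral_u, integral_v in *.
  rewrite H0, H3 in L1, L2.
  set (V := v h ^ 2) in *. set (D := du h ^ 2) in *.
  assert (E1 : D * (3 - V) = a * (3 - a)) by (unfold D, V in *; lra).
  assert (E2 : 3 * V ^ 2 - 12 * V + V * D = - 4 * a * (3 - a))
    by (unfold D, V in *; lra).
  assert (E : (V - 4) * (V - D) = 0) by lra.
  assert (HD : 0 <= D) by apply pow2_ge_0.
  destruct (Rmult_integral _ _ E) as [E'|E'].
  - assert (V = 4) by lra. nra.
  - split; [lra|]. assert (D = V) by lra.
    assert (E3 : (V - a) * (V - (3 - a)) = 0) by nra.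
    destruct (Rmult_integral _ _ E3); [left|right]; lra.
Qed.

Lemma is_derive_edge_wronskian a u du v dv y :
  manakov u du v dv -> on_level a u du v dv -> 0 < gap a (u y) (v y) ->
  is_derive (fun y => v y * dedge a u du v dv y - edge a u v y * dv y) y
    (- a * v y * edge a u v y).
Proof.
  intros H L Hpos.
  destruct (edge_solves a u du v dv y H L Hpos) as (_ & _ & _ & Hx & Hdx).
  destruct (H y) as (Hu & Hdu & Hv & Hdv).
  differentiate. ring.
Qed.

(** Let [x1], [x2] be the square roots for [3 - a] and [a], and [f] any of [u], [x1], [x2];
the quotient [q = f / v] satisfies [(v^2 q')' = (l - 4) v^2 q] with [l = 1], [1 + a],
[4 - a] respectively.  Hence the product [w = x1 x2 / v^2] satisfies
[(v^2 w')' = -3 v^2 w + 2 v^2 (x1 / v)' (x2 / v)'], which is the equation of [u / v]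
with one more term, and [M = v^2 ((u / v) w' - (u / v)' w)] has derivative
[2 v^2 (u / v) (x1 / v)' (x2 / v)'].  Now [x1 / v] starts with derivative zero and
decreases, whereas [x2 / v] increases and ends with derivative zero, so [M] is
strictly decreasing.  But it tends to [0] at both ends. *)
Lemma no_half_period a u du v dv h :
  0 < a < 3 -> a <> 3 / 2 -> 0 < h -> manakov u du v dv ->
  starts_at a u du v dv ->
  (forall y, 0 < y < h -> 0 < u y) -> u h = 0 -> dv h = 0 ->
  (forall y, 0 < v y) -> False.
Proof.
  intros Ha Ha' Hh H S Hu0 Huh Hdvh Hvpos.
  pose proof (start_on_level _ _ _ _ _ H S) as L.
  pose proof (level_symmetric _ _ _ _ _ L) as L'.
  assert (G2 : forall y, 0 < y <= h -> 0 < gap a (u y) (v y))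
    by exact (gap_positive a u du v dv h Ha Ha' H S Hu0 Huh).
  destruct S as (S0 & S1 & S2 & S3).
  destruct (level_at_return a u du v dv h Ha L Huh Hdvh) as [ED [EV|EV]].
  { specialize (G2 h). unfold gap in G2. rewrite Huh, EV in G2. lra. }
  assert (G1 : forall y, 0 <= y < h -> 0 < gap (3 - a) (u y) (v y)).
  { intros y Hy. replace y with (h - (h - y)) by ring.
    apply (gap_positive (3 - a) (fun y => u (h - y)) (fun y => - du (h - y))
      (fun y => v (h - y)) (fun y => - dv (h - y)) h);
      [lra|lra|exact (reflect_manakov h u du v dv H)| | | |].
    - unfold starts_at. rewrite Rminus_0_r, Huh, Hdvh.
      repeat split; [rewrite <- ED in EV; lra|exact EV|ring].
    - intros t Ht. apply Hu0; lra.
    - rewrite Rminus_diag. exact S0.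
    - lra. }
  assert (Z2 : gap a (u 0) (v 0) = 0) by (apply gap_at_start; assumption).
  assert (Z1 : gap (3 - a) (u h) (v h) = 0)
    by (unfold gap; rewrite Huh, EV; ring).
  pose (x1 := edge (3 - a) u v). pose (dx1 := dedge (3 - a) u du v dv).
  pose (x2 := edge a u v). pose (dx2 := dedge a u du v dv).
  (* [v^2 (x1 / v)'] and [v^2 (x2 / v)'] *)
  pose (N1 := fun y => v y * dx1 y - x1 y * dv y).
  pose (N2 := fun y => v y * dx2 y - x2 y * dv y).
  assert (X1 : forall y, 0 <= y < h -> 0 < x1 y).
  { intros y Hy. apply sqrt_lt_R0, G1, Hy. }
  assert (X2 : forall y, 0 < y <= h -> 0 < x2 y).
  { intros y Hy. apply sqrt_lt_R0, G2, Hy. }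
  assert (HN1 : forall y, 0 < y < h -> N1 y < 0).
  { intros y Hy. replace 0 with (N1 0) at 1.
    - apply (strictly_decreasing N1 (fun y => - (3 - a) * v y * x1 y)); [lra| |].
      + intros t Ht. apply is_derive_edge_wronskian; [exact H|exact L'|apply G1; lra].
      + intros t Ht. specialize (X1 t). specialize (Hvpos t).
        assert (0 < v t * x1 t) by (apply Rmult_lt_0_compat; lra). nra.
    - unfold N1, dx1, dedge, dgap. rewrite S0, S3. unfold Rdiv. ring. }
  assert (HN2 : forall y, 0 < y < h -> 0 < N2 y).
  { intros y Hy. replace 0 with (N2 h).
    - apply (strictly_decreasing N2 (fun y => - a * v y * x2 y)); [lra| |].
      + intros t Ht. apply is_derive_edge_wronskian; [exact H|exact L|apply G2; lra].
      + intros t Ht. specialize (X2 t). specialize (Hvpos t).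
        assert (0 < v t * x2 t) by (apply Rmult_lt_0_compat; lra). nra.
    - unfold N2, dx2, dedge, dgap. rewrite Huh, Hdvh. unfold Rdiv. ring. }
  pose (M := fun y => (u y * (x2 y * N1 y + x1 y * N2 y)
    - (v y * du y - u y * dv y) * (x1 y * x2 y)) / v y ^ 2).
  (* [B] bounds [N1 ^ 2] and [N2 ^ 2], and [K] bounds [M ^ 2], by expressions that
     remain smooth where [x1] or [x2] vanishes. *)
  pose (B := fun b y => 2 * (v y ^ 2 * dsqrtgap_sqr b (u y) (du y) (v y) (dv y)
    + gap b (u y) (v y) * dv y ^ 2)).
  pose (K := fun y => 3 * (u y ^ 2 * gap a (u y) (v y) * B (3 - a) y
    + u y ^ 2 * gap (3 - a) (u y) (v y) * B a y
    + (v y * du y - u y * dv y) ^ 2 * gap (3 - a) (u y) (v y) * gap a (u y) (v y))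
    / v y ^ 4).
  assert (HK : forall y, ex_derive K y).
  { intros y. destruct (H y) as (Hu & Hdu & Hv & Hdv).
    unfold K, B, dsqrtgap_sqr, gap. auto_derive.
    repeat split; try (eexists; eassumption).
    apply Rgt_not_eq. specialize (Hvpos y).
    repeat apply Rmult_lt_0_compat; lra. }
  assert (HMdec : forall s t, 0 < s -> s < t -> t < h -> M t < M s).
  { intros s t Hs st Ht.
    apply (strictly_decreasing M (fun y => 2 * u y * N1 y * N2 y / v y ^ 3));
      [exact st| |].
    - intros y Hy. specialize (Hvpos y).
      assert (HD1 : is_derive N1 y (- (3 - a) * v y * x1 y))
        by (apply is_derive_edge_wronskian; [exact H|exact L'|apply G1; lra]).
      assert (HD2 : is_derive N2 y (- a * v y * x2 y))
        by (apply is_derive_edge_wronskian; [exact H|exact L|apply G2; lra]).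
      destruct (edge_solves (3 - a) u du v dv y H L') as (_ & _ & _ & Hx1 & _);
        [apply G1; lra|].
      destruct (edge_solves a u du v dv y H L) as (_ & _ & _ & Hx2 & _);
        [apply G2; lra|].
      fold x1 dx1 in Hx1. fold x2 dx2 in Hx2.
      assert (E1 : dx1 y = (N1 y + x1 y * dv y) / v y) by (unfold N1; field; lra).
      assert (E2 : dx2 y = (N2 y + x2 y * dv y) / v y) by (unfold N2; field; lra).
      rewrite E1 in Hx1. rewrite E2 in Hx2.
      destruct (H y) as (Hu & Hdu & Hv & Hdv).
      unfold M. clearbody N1 N2 x1 x2. differentiate.
      + apply Rgt_not_eq. nra.
      + field. lra.
    - intros y Hy. specialize (Hvpos y).
      apply Rmult_neg_pos; [|apply Rinv_0_lt_compat, pow_lt, Hvpos].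
      assert (0 < u y) by (apply Hu0; lra).
      assert (N1 y < 0) by (apply HN1; lra). assert (0 < N2 y) by (apply HN2; lra).
      assert (0 < u y * N2 y) by (apply Rmult_lt_0_compat; lra). nra. }
  assert (HMK : forall y, 0 < y < h -> M y ^ 2 <= K y).
  { intros y Hy.
    destruct (edge_solves (3 - a) u du v dv y H L') as (_ & Q1 & D1 & _);
      [apply G1; lra|].
    destruct (edge_solves a u du v dv y H L) as (_ & Q2 & D2 & _);
      [apply G2; lra|].
    unfold K, B. rewrite <- Q1, <- Q2, <- D1, <- D2. fold x1 x2 dx1 dx2.
    assert (Q : forall p q : R, (p - q) ^ 2 <= 2 * (p ^ 2 + q ^ 2)).
    { intros p q. pose proof (pow2_ge_0 (p + q)). nra. }
    assert (BN1 : N1 y ^ 2 <= 2 * (v y ^ 2 * dx1 y ^ 2 + x1 y ^ 2 * dv y ^ 2)).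
    { unfold N1. rewrite <- !Rpow_mult_distr. apply Q. }
    assert (BN2 : N2 y ^ 2 <= 2 * (v y ^ 2 * dx2 y ^ 2 + x2 y ^ 2 * dv y ^ 2)).
    { unfold N2. rewrite <- !Rpow_mult_distr. apply Q. }
    unfold M. unfold Rdiv. rewrite Rpow_mult_distr.
    replace ((/ v y ^ 2) ^ 2) with (/ v y ^ 4) by (field; specialize (Hvpos y); lra).
    apply Rmult_le_compat_r.
    { left. apply Rinv_0_lt_compat, pow_lt, Hvpos. }
    assert (T : forall p q r : R, (p + q - r) ^ 2 <= 3 * (p ^ 2 + q ^ 2 + r ^ 2)).
    { intros p q r. pose proof (pow2_ge_0 (p - q)). pose proof (pow2_ge_0 (p + r)).
      pose proof (pow2_ge_0 (q + r)). nra. }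
    rewrite Rmult_plus_distr_l.
    eapply Rle_trans; [apply T|].
    apply Rmult_le_compat_l; [lra|]. apply Rplus_le_compat; [apply Rplus_le_compat|].
    - replace ((u y * (x2 y * N1 y)) ^ 2) with (u y ^ 2 * x2 y ^ 2 * N1 y ^ 2) by ring.
      apply Rmult_le_compat_l; [|exact BN1].
      apply Rmult_le_pos; apply pow2_ge_0.
    - replace ((u y * (x1 y * N2 y)) ^ 2) with (u y ^ 2 * x1 y ^ 2 * N2 y ^ 2) by ring.
      apply Rmult_le_compat_l; [|exact BN2].
      apply Rmult_le_pos; apply pow2_ge_0.
    - right. ring. }
  assert (Mneg : M (h / 2) < 0).
  { apply (negative_of_decreasing M K h HMdec HMK (HK 0)); [|lra].
    unfold K. rewrite Z2, S0. unfold Rdiv. ring. }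
  assert (Mpos : 0 < M (h / 2)).
  { apply (positive_of_decreasing M K h HMdec HMK (HK h)); [|lra].
    unfold K. rewrite Z1, Huh. unfold Rdiv. ring. }
  lra.
Qed.

(** * Uniqueness and parity *)

Lemma gronwall_zero (f df : R -> R) C : (forall y, is_derive f y (df y)) ->
  (forall y, df y <= C * f y) -> (forall y, 0 <= f y) -> f 0 = 0 ->
  forall y, 0 <= y -> f y = 0.
Proof.
  intros Hf Hdf Hpos H0 y Hy.
  destruct (Req_dec y 0) as [->|Hy0]; [exact H0|].
  destruct (MVT_cor2 (fun t => f t * exp (- C * t))
    (fun t => (df t - C * f t) * exp (- C * t)) 0 y) as [c [E _]]; [lra| |].
  - intros t _. apply is_derive_Reals. specialize (Hf t). differentiate. ring.
  - rewrite H0, Rmult_0_l, Rminus_0_r, Rminus_0_r in E.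
    assert (0 <= (C * f c - df c) * exp (- C * c) * y).
    { apply Rmult_le_pos; [apply Rmult_le_pos|lra].
      - specialize (Hdf c). lra.
      - left. apply exp_pos. }
    assert (0 < exp (- C * y)) by apply exp_pos.
    specialize (Hpos y). nra.
Qed.

Lemma weighted_young (p q c m : R) : - m <= c <= m -> 2 * p * (c * q) <= m * (p ^ 2 + q ^ 2).
Proof.
  intros Hc. pose proof (pow2_ge_0 (p - q)). pose proof (pow2_ge_0 (p + q)).
  destruct (Rle_dec 0 (p * q)); nra.
Qed.

(** The squared distance of two solutions in phase space grows at most at the
rate [100]: after factoring the differences out of the cubic nonlinearity, the
coefficients are bounded because [r <= 5] on both. *)
Lemma unique_forward u du v dv U dU V dV :
  manakov u du v dv -> manakov U dU V dV ->
  bounded_by_5 u v -> bounded_by_5 U V ->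
  u 0 = U 0 -> du 0 = dU 0 -> v 0 = V 0 -> dv 0 = dV 0 ->
  forall y, 0 <= y -> u y = U y /\ v y = V y.
Proof.
  intros H H' B B' E1 E2 E3 E4 y Hy.
  assert (Z : (u y - U y) ^ 2 + (du y - dU y) ^ 2
    + (v y - V y) ^ 2 + (dv y - dV y) ^ 2 = 0).
  { apply (gronwall_zero (fun y => (u y - U y) ^ 2 + (du y - dU y) ^ 2
      + (v y - V y) ^ 2 + (dv y - dV y) ^ 2)
     (fun y => let r := u y ^ 2 + v y ^ 2 in let R := U y ^ 2 + V y ^ 2 in
      2 * (u y - U y) * (du y - dU y)
      + 2 * (du y - dU y) * ((1 - 2 * r) * u y - (1 - 2 * R) * U y)
      + 2 * (v y - V y) * (dv y - dV y)
      + 2 * (dv y - dV y) * ((4 - 2 * r) * v y - (4 - 2 * R) * V y)) 100).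
    - intros t. destruct (H t) as (Hu & Hdu & Hv & Hdv).
      destruct (H' t) as (HU & HdU & HV & HdV).
      cbv zeta. differentiate. ring.
    - intros t; cbv zeta. specialize (B t). specialize (B' t).
      set (x := u t - U t). set (dx := du t - dU t).
      set (z := v t - V t). set (dz := dv t - dV t).
      assert (Hsq : forall p q, p ^ 2 <= 5 -> q ^ 2 <= 5 -> - 5 <= p * q <= 5).
      { intros p q Hp Hq. pose proof (pow2_ge_0 (p + q)).
        pose proof (pow2_ge_0 (p - q)). nra. }
      pose proof (pow2_ge_0 (u t)). pose proof (pow2_ge_0 (v t)).
      pose proof (pow2_ge_0 (U t)). pose proof (pow2_ge_0 (V t)).
      assert (Q1 := Hsq (u t) (U t) ltac:(lra) ltac:(lra)).
      assert (Q2 := Hsq (v t) (U t) ltac:(lra) ltac:(lra)).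
      assert (Q3 := Hsq (u t) (V t) ltac:(lra) ltac:(lra)).
      assert (Q4 := Hsq (v t) (V t) ltac:(lra) ltac:(lra)).
      assert (Q5 := Hsq (U t) (V t) ltac:(lra) ltac:(lra)).
      replace ((1 - 2 * (u t ^ 2 + v t ^ 2)) * u t - (1 - 2 * (U t ^ 2 + V t ^ 2)) * U t)
        with ((1 - 2 * (u t ^ 2 + v t ^ 2) - 2 * (u t * U t + U t ^ 2)) * x
          + - 2 * (v t * U t + U t * V t) * z) by (unfold x, z; ring).
      replace ((4 - 2 * (u t ^ 2 + v t ^ 2)) * v t - (4 - 2 * (U t ^ 2 + V t ^ 2)) * V t)
        with ((4 - 2 * (u t ^ 2 + v t ^ 2) - 2 * (v t * V t + V t ^ 2)) * z
          + - 2 * (u t * V t + U t * V t) * x) by (unfold x, z; ring).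
      assert (Y1 := weighted_young x dx 1 1 ltac:(lra)).
      assert (Y2 := weighted_young dx x
        (1 - 2 * (u t ^ 2 + v t ^ 2) - 2 * (u t * U t + U t ^ 2))
        29 ltac:(lra)).
      assert (Y3 := weighted_young dx z (- 2 * (v t * U t + U t * V t)) 20 ltac:(lra)).
      assert (Y4 := weighted_young z dz 1 1 ltac:(lra)).
      assert (Y5 := weighted_young dz z
        (4 - 2 * (u t ^ 2 + v t ^ 2) - 2 * (v t * V t + V t ^ 2))
        29 ltac:(lra)).
      assert (Y6 := weighted_young dz x (- 2 * (u t * V t + U t * V t)) 20 ltac:(lra)).
      pose proof (pow2_ge_0 x). pose proof (pow2_ge_0 dx).
      pose proof (pow2_ge_0 z). pose proof (pow2_ge_0 dz). lra.
    - intros t. repeat apply Rplus_le_le_0_compat; apply pow2_ge_0.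
    - rewrite E1, E2, E3, E4. ring.
    - exact Hy. }
  pose proof (pow2_ge_0 (u y - U y)). pose proof (pow2_ge_0 (du y - dU y)).
  pose proof (pow2_ge_0 (v y - V y)). pose proof (pow2_ge_0 (dv y - dV y)).
  split; apply Rminus_diag_uniq, Rsqr_0_uniq; rewrite Rsqr_pow2; lra.
Qed.

Lemma manakov_unique u du v dv U dU V dV :
  manakov u du v dv -> manakov U dU V dV ->
  bounded_by_5 u v -> bounded_by_5 U V ->
  u 0 = U 0 -> du 0 = dU 0 -> v 0 = V 0 -> dv 0 = dV 0 ->
  forall y, u y = U y /\ v y = V y.
Proof.
  intros H H' B B' E1 E2 E3 E4 y.
  destruct (Rle_dec 0 y) as [Hy|Hy].
  - apply (unique_forward u du v dv U dU V dV); assumption.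
  - replace y with (0 - (0 - y)) by ring.
    apply (unique_forward _ _ _ _ _ _ _ _ (reflect_manakov 0 u du v dv H)
      (reflect_manakov 0 U dU V dV H')); rewrite ?Rminus_0_r; try assumption; try lra.
    + intros t; apply B.
    + intros t; apply B'.
Qed.

(** The map [(u, v) (y) -> (- u, v) (- y)] preserves the system and the initial data. *)
Lemma u_odd_v_even u du v dv : manakov u du v dv -> bounded_by_5 u v ->
  u 0 = 0 -> dv 0 = 0 -> forall y, u (- y) = - u y /\ v (- y) = v y.
Proof.
  intros H B H0 H3 y.
  destruct (manakov_unique u du v dv _ _ _ _ H
    (negate_manakov _ _ _ _ (reflect_manakov 0 u du v dv H)) B) with (y := - y)
    as [Eu Ev]; rewrite ?Rminus_0_r; try lra.
  - intros t; cbv beta. replace ((- u (0 - t)) ^ 2) with (u (0 - t) ^ 2) by ring. apply B.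
  - replace (0 - - y) with y in * by ring. split; assumption.
Qed.

(** * Initial values with [a >= 3] *)

Lemma local_minimum v dv m eps (l : R) : 0 < eps ->
  (forall y, is_derive v y (dv y)) -> is_derive dv m l ->
  (forall y, m - eps < y < m + eps -> v m <= v y) -> dv m = 0 /\ 0 <= l.
Proof.
  intros Heps Hv Hdv Hmin.
  assert (D0 : dv m = 0).
  { pose proof (proj1 (is_derive_Reals _ _ _) (Hv m)) as D.
    pose (pr := exist _ (dv m) D : derivable_pt v m).
    change (derive_pt v m pr = 0).
    apply (deriv_minimum v (m - eps) (m + eps)); [lra|lra|].
    intros y Hy1 Hy2. apply Hmin; lra. }
  split; [exact D0|]. apply Rnot_lt_le; intros Hl.
  destruct (positive_right_of_zero (fun y => - dv (m + y)) (- l)) as [d [Hd Hpos]].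
  - assert (Hdv' : is_derive dv (m + 0) l) by (rewrite Rplus_0_r; exact Hdv).
    differentiate. ring.
  - lra.
  - rewrite Rplus_0_r, D0. ring.
  - pose (s := Rmin d eps / 2).
    assert (0 < Rmin d eps) by (apply Rmin_glb_lt; lra).
    pose proof (Rmin_l d eps). pose proof (Rmin_r d eps).
    assert (K : v (m + s) < v m).
    { apply (strictly_decreasing v dv); [unfold s; lra|intros; apply Hv|].
      intros y Hy. specialize (Hpos (y - m)).
      replace (m + (y - m)) with y in Hpos by ring. unfold s in Hy. lra. }
    specialize (Hmin (m + s)). unfold s in *. lra.
Qed.

(** The minimum over one closed period may sit at an end of it; periodicity still makes
it a minimum over a neighbourhood. *)
Lemma periodic_minimum (v : R -> R) T : 0 < T -> (forall y, ex_derive v y) ->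
  (forall y, v (y + T) = v y) ->
  exists m, forall y, m - T < y < m + T -> v m <= v y.
Proof.
  intros HT Hv Hper.
  destruct (continuity_ab_min v 0 T) as [m [Hmin Hm]]; [lra| |].
  { intros y _. apply continuity_pt_filterlim, (ex_derive_continuous v), Hv. }
  exists m. intros y Hy.
  destruct (Rlt_dec y 0); [|destruct (Rle_dec y T)].
  - rewrite <- (Hper y). apply Hmin. lra.
  - apply Hmin; lra.
  - replace y with (y - T + T) by ring. rewrite Hper. apply Hmin. lra.
Qed.

(** At a minimum of [v], [v' = 0] and [v'' >= 0] force [r <= 2].  For [a >= 3] the second
integral is nonnegative, which gives [u'^2 >= 3 (4 - r)]; the first is nonpositive,
and with [1 - v^2 / 3 >= (1 + u^2) / 3] this yields [4 - r + 3 u^2 <= 0],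
which [r <= 2] excludes. *)
Lemma no_periodic_positive_above a u du v dv T : 3 <= a ->
  manakov u du v dv -> on_level a u du v dv -> 0 < T ->
  (forall y, v (y + T) = v y) -> (forall y, 0 < v y) -> False.
Proof.
  intros Ha H L HT Hper Hpos.
  destruct (periodic_minimum v T HT) as [m Hm]; [|exact Hper|].
  { intros y. eexists; apply (H y). }
  destruct (local_minimum v dv m T _ HT (fun y => proj1 (proj2 (proj2 (H y))))
    (proj2 (proj2 (proj2 (H m)))) Hm) as [D0 D2].
  destruct (L m) as [L1 L2]. unfold integral_u, integral_v in *. rewrite D0 in L1, L2.
  specialize (Hpos m).
  set (U := u m ^ 2) in *. set (V := v m ^ 2) in *. set (D := du m ^ 2).
  assert (HU : 0 <= U) by apply pow2_ge_0.
  assert (HV : 0 < V) by (apply pow_lt; exact Hpos).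
  assert (Hr : U + V <= 2).
  { apply Rnot_lt_le; intros C. nra. }
  replace ((u m * 0 - v m * du m) ^ 2) with (V * D) in * by (unfold V, D; ring).
  fold D in L1.
  assert (A1 : 0 <= V * (U + V - 4 + D / 3)) by nra.
  assert (A2 : 0 <= U + V - 4 + D / 3).
  { apply Rnot_lt_le; intros C. nra. }
  nra.
Qed.

(** * The initial value is forced *)

Lemma ivp_manakov p phi1 phi2 : ivp_solution p phi1 phi2 ->
  manakov phi1 (Derive phi1) (fun y => 2 * phi2 y) (fun y => 2 * Derive phi2 y).
Proof.
  intros (D1 & D2 & E1 & E2 & _) y.
  split; [apply Derive_correct, D1|]. split; [|split].
  - evar_last; [apply E1|ring].
  - apply is_derive_scal, Derive_correct, D2.
  - evar_last; [apply is_derive_scal, E2|ring].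
Qed.

Lemma ivp_starts_at p phi1 phi2 : ivp_solution p phi1 phi2 ->
  starts_at (4 * p ^ 2) phi1 (Derive phi1) (fun y => 2 * phi2 y)
    (fun y => 2 * Derive phi2 y).
Proof.
  intros (_ & _ & _ & _ & E1 & E2 & E3 & E4).
  unfold starts_at. rewrite E1, E2, E3, E4. repeat split; ring.
Qed.

Lemma ivp_bounded p phi1 phi2 : 0 < p <= 1 -> ivp_solution p phi1 phi2 ->
  bounded_by_5 phi1 (fun y => 2 * phi2 y).
Proof.
  intros Hp H y.
  apply (level_bounded (4 * p ^ 2) _ (Derive phi1) (fun y => 2 * phi2 y)
    (fun y => 2 * Derive phi2 y)); [nra|].
  apply start_on_level; [apply (ivp_manakov p), H|apply ivp_starts_at, H].
Qed.

Lemma positive_until_zero (f : R -> R) (l h : R) : (forall y, ex_derive f y) ->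
  f 0 = 0 -> is_derive f 0 l -> 0 < l ->
  (forall y, 0 < y < h -> f y <> 0) -> forall y, 0 < y < h -> 0 < f y.
Proof.
  intros Hf H0 Hl l0 Hne y Hy.
  destruct (positive_right_of_zero f l Hl l0 H0) as [d [Hd Hpos]].
  destruct (positive_or_first_zero f y d Hf Hd Hpos) as [A|[z (Hz & Hfz & _)]].
  - apply A; lra.
  - exfalso. apply (Hne z); lra.
Qed.

(** Both [0] and, for each zero [z] of [f], [T - z] are zeros; as there is only one zero
besides [0] in the period, it is its own mirror image. *)
Lemma half_period_zero f T : 0 < T -> (forall y, f (y + T) = f y) ->
  (forall y, f (- y) = - f y) -> exactly_two_zeros_in f 0 (0 + T) ->
  f (T / 2) = 0 /\ forall y, 0 < y < T / 2 -> f y <> 0.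
Proof.
  intros HT Hper Hodd (z1 & z2 & Hz & Hiff).
  assert (f0 : f 0 = 0) by (specialize (Hodd 0); rewrite Ropp_0 in Hodd; lra).
  assert (Hrefl : forall z, f z = 0 -> f (T - z) = 0).
  { intros z Hfz. replace (T - z) with (- z + T) by ring.
    rewrite Hper, Hodd, Hfz. ring. }
  assert (Hz0 : exists z, 0 < z < T /\ f z = 0 /\
    forall y, 0 < y < T -> f y = 0 -> y = z).
  { destruct (proj1 (Hiff 0)) as [E|E]; [split; [lra|exact f0]| |].
    - exists z2. destruct (proj2 (Hiff z2)) as [A B]; [right; reflexivity|].
      split; [lra|]. split; [exact B|]. intros y Hy Hfy.
      destruct (proj1 (Hiff y)); [split; [lra|exact Hfy]|lra|assumption].
    - exists z1. destruct (proj2 (Hiff z1)) as [A B]; [left; reflexivity|].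
      split; [lra|]. split; [exact B|]. intros y Hy Hfy.
      destruct (proj1 (Hiff y)); [split; [lra|exact Hfy]|assumption|lra]. }
  destruct Hz0 as (z & Hz0 & Hfz & Huniq).
  assert (E : T - z = z) by (apply Huniq; [lra|apply Hrefl, Hfz]).
  replace (T / 2) with z by lra. split; [exact Hfz|].
  intros y Hy Hfy. specialize (Huniq y ltac:(lra) Hfy). lra.
Qed.

Lemma admissible_initial_value q psi1 psi2 :
  admissible_solution q psi1 psi2 -> q = sqrt (3 / 8).
Proof.
  intros (Hq & Hivp & _ & (T & ((HT & Hper) & _) & Htwo) & Hpos).
  pose proof (ivp_manakov _ _ _ Hivp) as H.
  pose proof (ivp_starts_at _ _ _ Hivp) as S.
  pose proof (ivp_bounded _ _ _ Hq Hivp) as B.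
  pose proof (start_on_level _ _ _ _ _ H S) as L.
  destruct Hivp as (_ & _ & _ & _ & I1 & _ & I3 & I4).
  set (a := 4 * q ^ 2) in *.
  assert (Ha : 0 < a) by (unfold a; nra).
  destruct (Req_dec a (3 / 2)) as [E|Hne].
  { symmetry. apply sqrt_lem_1; unfold a in E; nra. }
  exfalso.
  assert (Hvper : forall y, 2 * psi2 (y + T) = 2 * psi2 y)
    by (intros y; rewrite (proj2 (Hper y)); reflexivity).
  assert (Hvpos : forall y, 0 < 2 * psi2 y) by (intros y; specialize (Hpos y); lra).
  destruct (Rle_dec 3 a) as [Ha3|Ha3].
  { exact (no_periodic_positive_above a _ _ (fun y => 2 * psi2 y) _ T Ha3 H L HT
      Hvper Hvpos). }
  pose proof (u_odd_v_even _ _ _ _ H B I1 ltac:(cbv beta; rewrite I4; ring)) as P.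
  destruct (half_period_zero psi1 T HT (fun y => proj1 (Hper y))
    (fun y => proj1 (P y)) (Htwo 0)) as [Hzero Hnz].
  apply (no_half_period a psi1 (Derive psi1) (fun y => 2 * psi2 y)
    (fun y => 2 * Derive psi2 y) (T / 2)); try assumption; try lra.
  - apply (positive_until_zero psi1 (2 * q)); try assumption; try lra.
    + intros y. eexists; apply (H y).
    + rewrite <- I3. apply (H 0).
  - assert (Hsym : forall y, 2 * psi2 (T / 2 - y) = 2 * psi2 (T / 2 + y)).
    { intros y. rewrite <- (proj2 (P (T / 2 - y))), <- Hvper.
      replace (- (T / 2 - y) + T) with (T / 2 + y) by field. reflexivity. }
    destruct (H (T / 2)) as (_ & _ & Hv & _).
    assert (Hp : is_derive (fun y => 2 * psi2 y) (T / 2 + 0) (2 * Derive psi2 (T / 2)))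
      by (rewrite Rplus_0_r; exact Hv).
    assert (Hm : is_derive (fun y => 2 * psi2 y) (T / 2 - 0) (2 * Derive psi2 (T / 2)))
      by (rewrite Rminus_0_r; exact Hv).
    assert (Dp : is_derive (fun y => 2 * psi2 (T / 2 + y)) 0 (2 * Derive psi2 (T / 2))).
    { evar_last.
      - apply (is_derive_comp (fun y => 2 * psi2 y) (fun y => T / 2 + y) 0 _ 1 Hp).
        auto_derive; [exact I|ring].
      - unfold scal; simpl; unfold mult; simpl; ring. }
    assert (Dm : is_derive (fun y => 2 * psi2 (T / 2 - y)) 0 (- (2 * Derive psi2 (T / 2)))).
    { evar_last.
      - apply (is_derive_comp (fun y => 2 * psi2 y) (fun y => T / 2 - y) 0 _ (- 1) Hm).
        auto_derive; [exact I|ring].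
      - unfold scal; simpl; unfold mult; simpl; ring. }
    apply (is_derive_ext _ _ _ _ Hsym) in Dm.
    pose proof (eq_trans (eq_sym (is_derive_unique _ _ _ Dp))
      (is_derive_unique _ _ _ Dm)) as E.
    cbv beta. simpl in E. lra.
Qed.

(** * The solution for [a = 3/2] *)

(** [Y] is the time needed to reach [t], the integral of [1 / w], and the solution [g]
of [g' = w (g)] is its inverse.  The bound [w <= b] makes [Y] grow at least
linearly, so that [g] is defined for all times and is Lipschitz. *)
Lemma autonomous_flow (w : R -> R) (b : R) :
  (forall t, ex_derive w t) -> (forall t, 0 < w t <= b) ->
  exists Y g : R -> R, Y 0 = 0 /\
    (forall t, is_derive Y t (/ w t)) /\ (forall s t, s < t -> Y s < Y t) /\
    (forall y, Y (g y) = y) /\ (forall y, is_derive g y (w (g y))).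
Proof.
  intros Hw Hb.
  assert (Hb0 : 0 < b) by (specialize (Hb 0); lra).
  assert (Hinv : forall t, ex_derive (fun t => / w t) t).
  { intros t. apply ex_derive_inv; [apply Hw|]. specialize (Hb t). lra. }
  pose (Y := RInt (fun t => / w t) 0 : R -> R).
  assert (HY : forall t, is_derive Y t (/ w t)).
  { intros t. apply (is_derive_RInt (fun t => / w t) Y 0 t).
    - apply filter_forall. intros z. apply (RInt_correct (fun t => / w t)).
      apply (ex_RInt_continuous (fun t => / w t)). intros x _.
      apply (ex_derive_continuous (fun t => / w t)), Hinv.
    - apply (ex_derive_continuous (fun t => / w t)), Hinv. }
  assert (Hmvt : forall s t, s < t -> exists c, Y t - Y s = / w c * (t - s) /\ s < c < t).
  { intros s t st. apply (MVT_cor2 Y (fun t => / w t) s t st).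
    intros c _. apply is_derive_Reals, HY. }
  assert (Hexp : forall s t, s <= t -> (t - s) / b <= Y t - Y s).
  { intros s t [st| ->]; [|unfold Rdiv; lra].
    destruct (Hmvt s t st) as [c [-> _]]. specialize (Hb c).
    unfold Rdiv. rewrite Rmult_comm. apply Rmult_le_compat_r; [lra|].
    apply Rinv_le_contravar; lra. }
  assert (Hlt : forall s t, s < t -> Y s < Y t).
  { intros s t st. specialize (Hexp s t ltac:(lra)).
    assert (0 < (t - s) / b) by (apply Rdiv_lt_0_compat; lra). lra. }
  assert (Y0 : Y 0 = 0) by exact (RInt_point 0 (fun t => / w t)).
  assert (Hsurj : forall y, {t | Y t = y}).
  { intros y. pose (c := b * (Rabs y + 1)).
    assert (Hc : 0 < c).
    { apply Rmult_lt_0_compat; [lra|]. pose proof (Rabs_pos y). lra. }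
    assert (Hcb : c / b = Rabs y + 1) by (unfold c; field; lra).
    destruct (IVT (fun t => Y t - y) (- c) c) as [t [_ Ht]].
    - intros t. apply continuity_pt_filterlim, (ex_derive_continuous (fun t => Y t - y)).
      eexists. apply (is_derive_minus Y (fun _ => y)); [apply HY|apply is_derive_const].
    - lra.
    - specialize (Hexp (- c) 0 ltac:(lra)).
      replace ((0 - - c) / b) with (c / b) in Hexp by (unfold Rdiv; ring).
      pose proof (Rle_abs (- y)) as A. rewrite Rabs_Ropp in A. lra.
    - specialize (Hexp 0 c ltac:(lra)). rewrite Rminus_0_r in Hexp.
      pose proof (Rle_abs y). lra.
    - exists t. lra. }
  pose (g := fun y => proj1_sig (Hsurj y)).
  assert (Hg : forall y, Y (g y) = y) by (intros y; exact (proj2_sig (Hsurj y))).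
  exists Y, g. do 4 (split; [assumption|]).
  intros y. apply is_derive_Reals. intros eps Heps.
  destruct (continuity_eps w (g y) (Hw (g y)) eps Heps) as [d [Hd Hnear]].
  assert (Hdb : 0 < d / b) by (apply Rdiv_lt_0_compat; lra).
  exists (mkposreal _ Hdb). intros k Hk0 Hk; simpl in Hk.
  assert (Hlip : Rabs (g (y + k) - g y) <= b * Rabs k).
  { assert (E : k = Y (g (y + k)) - Y (g y)) by (rewrite !Hg; ring).
    destruct (Rle_dec (g y) (g (y + k))) as [O|O].
    - specialize (Hexp _ _ O). rewrite <- E in Hexp.
      rewrite Rabs_pos_eq by lra. pose proof (Rle_abs k).
      apply Rmult_le_compat_l with (r := b) in Hexp; [|lra].
      replace (b * ((g (y + k) - g y) / b)) with (g (y + k) - g y) in Hexp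
        by (field; lra). nra.
    - specialize (Hexp (g (y + k)) (g y) ltac:(lra)).
      rewrite Rabs_left by lra. pose proof (Rle_abs (- k)) as A. rewrite Rabs_Ropp in A.
      apply Rmult_le_compat_l with (r := b) in Hexp; [|lra].
      replace (b * ((g y - g (y + k)) / b)) with (g y - g (y + k)) in Hexp
        by (field; lra). nra. }
  assert (Hlip' : Rabs (g (y + k) - g y) < d).
  { apply Rle_lt_trans with (1 := Hlip).
    apply Rmult_lt_compat_l with (r := b) in Hk; [|lra].
    replace (b * (d / b)) with d in Hk by (field; lra). exact Hk. }
  apply Rabs_def2 in Hlip'.
  assert (Hc : exists c, k = / w c * (g (y + k) - g y) /\ Rabs (c - g y) < d).
  { destruct (Rtotal_order (g y) (g (y + k))) as [O|[O|O]].
    - destruct (Hmvt _ _ O) as [c [E Hc]]. exists c.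
      rewrite !Hg in E. split; [lra|]. apply Rabs_def1; lra.
    - exfalso. apply Hk0. apply (f_equal Y) in O. rewrite !Hg in O. lra.
    - destruct (Hmvt _ _ O) as [c [E Hc]]. exists c.
      rewrite !Hg in E. split; [lra|]. apply Rabs_def1; lra. }
  (* the difference quotient of [g] is the value of [w] at the mean-value point *)
  destruct Hc as [c [E Hc]].
  assert (Hwc : w c <> 0) by (specialize (Hb c); lra).
  replace ((g (y + k) - g y) / k) with (w c); [apply Hnear, Hc|].
  assert (Hgk : g (y + k) - g y = w c * k) by (rewrite E at 2; field; exact Hwc).
  rewrite Hgk. field. exact Hk0.
Qed.

Definition speed (t : R) : R := sqrt (3 + sin t ^ 2).

Lemma speed_sqr t : speed t ^ 2 = 3 + sin t ^ 2.
Proof. unfold speed. apply pow2_sqrt. pose proof (pow2_ge_0 (sin t)). lra. Qed.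

Lemma speed_bounds t : 0 < speed t <= 2.
Proof.
  pose proof (pow2_ge_0 (sin t)). split.
  - apply sqrt_lt_R0. lra.
  - replace 2 with (sqrt 4) by (replace 4 with (2 ^ 2) by ring; apply sqrt_pow2; lra).
    apply sqrt_le_1_alt. pose proof (SIN_bound t). nra.
Qed.

Lemma is_derive_speed t : is_derive speed t (sin t * cos t / speed t).
Proof.
  pose proof (pow2_ge_0 (sin t)). unfold speed at 1. auto_derive; [lra|].
  change (sqrt (3 + sin t * (sin t * 1))) with (speed t).
  field. pose proof (speed_bounds t). lra.
Qed.

Lemma speed_pi t : speed (t + PI) = speed t.
Proof. unfold speed. rewrite neg_sin. f_equal. ring. Qed.

Lemma sqrt2_sqr : sqrt 2 ^ 2 = 2.
Proof. apply pow2_sqrt. lra. Qed.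

Lemma sqrt2_pos : 0 < sqrt 2.
Proof. apply sqrt_lt_R0. lra. Qed.

(** On the hyperbola [v^2 - u^2 = 3/2], [r = 3/2 + sin^2 g] and [v'] simplifies to
[sin g cos g / sqrt 2]. *)
Lemma explicit_manakov (g : R -> R) : (forall y, is_derive g y (speed (g y))) ->
  manakov (fun y => sin (g y) / sqrt 2) (fun y => cos (g y) * speed (g y) / sqrt 2)
    (fun y => speed (g y) / sqrt 2) (fun y => sin (g y) * cos (g y) / sqrt 2).
Proof.
  intros Hg y. specialize (Hg y).
  pose proof sqrt2_pos. pose proof (speed_bounds (g y)) as Hb.
  assert (Hs : is_derive (fun y => speed (g y)) y (sin (g y) * cos (g y))).
  { evar_last; [apply (is_derive_comp speed g); [apply is_derive_speed|exact Hg]|].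
    unfold scal; simpl; unfold mult; simpl. field. lra. }
  assert (Hcos : cos (g y) ^ 2 = 1 - sin (g y) ^ 2)
    by (pose proof (sin2_cos2 (g y)) as E; rewrite !Rsqr_pow2 in E; lra).
  assert (Hr : (sin (g y) / sqrt 2) ^ 2 + (speed (g y) / sqrt 2) ^ 2
    = 3 / 2 + sin (g y) ^ 2).
  { unfold Rdiv. rewrite !Rpow_mult_distr, speed_sqr, pow_inv, sqrt2_sqr. field. }
  split; [|split; [|split]]; cbv beta; rewrite ?Hr.
  - differentiate. field. lra.
  - assert (D : forall f : R -> R, is_derive f y (sin (g y) * cos (g y)) ->
      f y = speed (g y) -> is_derive (fun y => cos (g y) * f y / sqrt 2) y
        ((- sin (g y) * speed (g y) ^ 2 + sin (g y) * cos (g y) ^ 2) / sqrt 2)).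
    { intros f Hf E. differentiate. rewrite E. field. lra. }
    evar_last; [exact (D (fun y => speed (g y)) Hs eq_refl)|].
    rewrite Hcos, speed_sqr. field. lra.
  - evar_last.
    + apply (is_derive_scal_l (fun y => speed (g y)) y (sin (g y) * cos (g y)) (/ sqrt 2)).
      exact Hs.
    + unfold scal; simpl; unfold mult; simpl. reflexivity.
  - evar_last; [differentiate; reflexivity|].
    transitivity ((cos (g y) ^ 2 - sin (g y) ^ 2) * speed (g y) / sqrt 2);
      [field; lra|]. rewrite Hcos. field. lra.
Qed.

Lemma is_derive_halve (f : R -> R) y (l : R) :
  is_derive (fun y => 2 * f y) y l -> is_derive f y (l / 2).
Proof.
  intros H. apply (is_derive_ext (fun y => / 2 * (2 * f y))).
  - intros t. simpl. field.
  - evar_last; [apply is_derive_scal, H|]. field.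
Qed.

Lemma manakov_ivp p phi1 du phi2 dphi2 :
  manakov phi1 du (fun y => 2 * phi2 y) (fun y => 2 * dphi2 y) ->
  phi1 0 = 0 -> phi2 0 = p -> du 0 = 2 * p -> dphi2 0 = 0 ->
  ivp_solution p phi1 phi2.
Proof.
  intros H H0 H1 H2 H3.
  assert (D1 : forall y, Derive phi1 y = du y)
    by (intros y; apply is_derive_unique, (H y)).
  assert (H2' : forall y, is_derive phi2 y (dphi2 y)).
  { intros y. destruct (H y) as (_ & _ & Hv & _).
    evar_last; [exact (is_derive_halve _ _ _ Hv)|]. field. }
  assert (D2 : forall y, Derive phi2 y = dphi2 y)
    by (intros y; apply is_derive_unique, H2').
  split; [intros y; eexists; apply (H y)|].
  split; [intros y; eexists; apply H2'|].
  split; [|split; [|rewrite D1, D2; auto]]; intros y;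
    destruct (H y) as (_ & Hdu & _ & Hdv).
  - apply (is_derive_ext du); [intros t; symmetry; apply D1|].
    evar_last; [exact Hdu|ring].
  - apply (is_derive_ext dphi2); [intros t; symmetry; apply D2|].
    evar_last; [exact (is_derive_halve _ _ _ Hdv)|]. field.
Qed.

(** As [speed] has period [PI], the time [Y PI] of a half turn of [g] does not depend on its
start, so [g (y + Y PI) = g y + PI].  The zeros of [phi1] are the times
[Y (k PI)]; [phi2] already repeats after [Y PI] but [phi1] changes sign, so the least
common period is [2 Y PI]. *)
Lemma admissible_solution_exists :
  exists phi1 phi2, admissible_solution (sqrt (3 / 8)) phi1 phi2.
Proof.
  destruct (autonomous_flow speed 2) as (Y & g & Y0 & HY & Hinc & HYg & Hg).
  { intros t. eexists; apply is_derive_speed. }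
  { apply speed_bounds. }
  pose proof sqrt2_pos as R2.
  assert (Hinj : forall s t, Y s = Y t -> s = t).
  { intros s t E. destruct (Rtotal_order s t) as [O|[O|O]]; [|exact O|];
      specialize (Hinc _ _ O); lra. }
  assert (HgY : forall t, g (Y t) = t) by (intros t; apply Hinj, HYg).
  assert (Hinc' : forall s t, s < t -> g s < g t).
  { intros s t st. apply Rnot_le_lt; intros [C|C].
    - specialize (Hinc _ _ C). rewrite !HYg in Hinc. lra.
    - apply (f_equal Y) in C. rewrite !HYg in C. lra. }
  assert (g0 : g 0 = 0) by (rewrite <- Y0 at 1; apply HgY).
  pose proof PI_RGT_0 as Hpi.
  assert (HYpi : forall t, Y (t + PI) = Y t + Y PI).
  { intros t.
    pose proof (zero_derivative_constant (fun t => Y (t + PI) - Y t)) as C.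
    cbv beta in C. rewrite Rplus_0_l, Y0 in C.
    rewrite <- (Rminus_0_r (Y PI)), <- C with (y := t); [ring|].
    intros s. pose proof (HY s) as D1. pose proof (HY (s + PI)) as D2.
    differentiate. rewrite speed_pi. ring. }
  assert (HT : 0 < Y PI) by (rewrite <- Y0; apply Hinc, Hpi).
  assert (Hgh : forall y, g (y + Y PI) = g y + PI).
  { intros y. apply Hinj. rewrite HYg, HYpi, HYg. reflexivity. }
  assert (HgT : forall y, g (y + 2 * Y PI) = g y + 2 * PI).
  { intros y. replace (y + 2 * Y PI) with (y + Y PI + Y PI) by ring.
    rewrite !Hgh. ring. }
  set (phi1 := fun y => sin (g y) / sqrt 2).
  set (phi2 := fun y => speed (g y) / sqrt 2 / 2).
  assert (Hphi1 : forall y, phi1 y = 0 <-> sin (g y) = 0).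
  { intros y. unfold phi1. split; intros E.
    - replace (sin (g y)) with (sin (g y) / sqrt 2 * sqrt 2) by (field; lra).
      rewrite E. ring.
    - rewrite E. unfold Rdiv. ring. }
  assert (Hper : common_period phi1 phi2 (2 * Y PI)).
  { split; [lra|]. intros y. unfold phi1, phi2, speed. rewrite HgT.
    rewrite sin_plus, sin_2PI, cos_2PI, Rmult_1_r, Rmult_0_r, Rplus_0_r. auto. }
  assert (Hleast : least_common_period phi1 phi2 (2 * Y PI)).
  { split; [exact Hper|]. intros S [HS HSper].
    apply Rnot_lt_le; intros C.
    assert (Hz : sin (g S) = 0).
    { apply Hphi1. replace S with (0 + S) by ring. rewrite (proj1 (HSper 0)).
      apply Hphi1. rewrite g0. apply sin_0. }
    assert (Hlt : 0 < g S < 2 * PI).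
    { split; [rewrite <- g0; apply Hinc', HS|].
      replace (2 * PI) with (g (2 * Y PI)); [apply Hinc', C|].
      replace (2 * Y PI) with (0 + 2 * Y PI) by ring. rewrite HgT, g0. ring. }
    assert (E : g S = PI).
    { destruct (sin_eq_0_0 _ Hz) as [k Hk].
      assert (k = 1%Z); [|subst k; lra].
      assert (0 < IZR k < 2) by (rewrite Hk in Hlt; nra).
      apply Z.le_antisymm; [apply Z.lt_succ_r|apply (Z.le_succ_l 0)];
        apply lt_IZR; simpl; lra. }
    assert (ES : S = Y PI) by (rewrite <- E, HYg; reflexivity).
    (* after a half turn [phi1] has the opposite sign, seen at its maximum *)
    pose proof (proj1 (HSper (Y (PI / 2)))) as F. unfold phi1 in F.
    rewrite ES, Hgh, HgY, neg_sin, sin_PI2 in F.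
    assert (0 < / sqrt 2) by (apply Rinv_0_lt_compat, R2). lra. }
  exists phi1, phi2.
  assert (Hp : 2 * sqrt (3 / 8) = sqrt 3 / sqrt 2).
  { rewrite <- sqrt_div_alt by lra.
    replace (3 / 2) with (2 ^ 2 * (3 / 8)) by field.
    rewrite sqrt_mult, sqrt_pow2 by lra. ring. }
  assert (Hs0 : speed 0 = sqrt 3).
  { unfold speed. rewrite sin_0. f_equal. ring. }
  split; [split|].
  { apply sqrt_lt_R0. lra. }
  { rewrite <- sqrt_1. apply sqrt_le_1_alt. lra. }
  split.
  { apply (manakov_ivp _ _ (fun y => cos (g y) * speed (g y) / sqrt 2) _
      (fun y => sin (g y) * cos (g y) / sqrt 2 / 2)).
    - assert (E : forall z, 2 * (z / 2) = z) by (intros; field).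
      intros y. destruct (explicit_manakov g Hg y) as (A1 & A2 & A3 & A4).
      unfold phi1, phi2. rewrite E.
      split; [exact A1|]. split; [exact A2|]. split.
      + apply (is_derive_ext (fun y => speed (g y) / sqrt 2));
          [intros; rewrite E; reflexivity|]. rewrite E. exact A3.
      + apply (is_derive_ext (fun y => sin (g y) * cos (g y) / sqrt 2));
          [intros; rewrite E; reflexivity|]. exact A4.
    - apply Hphi1. rewrite g0. apply sin_0.
    - unfold phi2. rewrite g0, Hs0, <- Hp. field.
    - rewrite g0, Hs0, cos_0, Hp. field. lra.
    - rewrite g0, sin_0. unfold Rdiv. ring. }
  split; [exists (2 * Y PI); exact Hper|].
  split.
  - exists (2 * Y PI). split; [exact Hleast|]. intros y0.
    destruct (base_Int_part (- (g y0 / PI))) as [B1 B2].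
    (* [n] is the ceiling of [g y0 / PI], so that [n PI] and [(n + 1) PI] are the
       multiples of [PI] in the half-open turn starting at [g y0] *)
    set (n := (- Int_part (- (g y0 / PI)))%Z).
    assert (Hn : IZR n - 1 < g y0 / PI <= IZR n)
      by (unfold n; rewrite opp_IZR; lra).
    assert (Hgn : (IZR n - 1) * PI < g y0 <= IZR n * PI).
    { replace (g y0) with (g y0 / PI * PI) by (field; lra). split.
      - apply Rmult_lt_compat_r; lra.
      - apply Rmult_le_compat_r; lra. }
    assert (Hsin : forall k, sin (IZR k * PI) = 0)
      by (intros k; apply sin_eq_0_1; exists k; reflexivity).
    assert (Hle : forall k, g y0 <= IZR k * PI < g y0 + 2 * PI ->
      y0 <= Y (IZR k * PI) < y0 + 2 * Y PI /\ phi1 (Y (IZR k * PI)) = 0).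
    { intros k [K1 K2]. split; [|apply Hphi1; rewrite HgY; apply Hsin].
      split; [apply Rnot_lt_le|apply Rnot_le_lt]; intros C.
      - apply Hinc' in C. rewrite HgY in C. lra.
      - destruct C as [C|C].
        + apply Hinc' in C. rewrite HgY, HgT in C. lra.
        + apply (f_equal g) in C. rewrite HgY, HgT in C. lra. }
    exists (Y (IZR n * PI)), (Y (IZR (n + 1) * PI)).
    split.
    { rewrite plus_IZR. apply Rlt_not_eq, Hinc. lra. }
    intros z. split.
    + intros [[Z1 Z2] Hz].
      apply Hphi1 in Hz. destruct (sin_eq_0_0 _ Hz) as [k Hk].
      assert (Hzk : z = Y (IZR k * PI)) by (rewrite <- Hk, HYg; reflexivity).
      assert (G1 : g y0 <= IZR k * PI).
      { rewrite <- Hk. destruct Z1 as [Z1|Z1]; [left; apply Hinc', Z1|right; congruence]. }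
      assert (G2 : IZR k * PI < g y0 + 2 * PI) by (rewrite <- Hk, <- HgT; apply Hinc', Z2).
      assert (K1 : (n - 1 < k)%Z) by (apply lt_IZR; rewrite minus_IZR; nra).
      assert (K2 : (k < n + 2)%Z) by (apply lt_IZR; rewrite plus_IZR; nra).
      assert (K : k = n \/ k = (n + 1)%Z) by lia.
      rewrite Hzk. destruct K as [-> | ->]; auto.
    + intros [-> | ->]; apply Hle; rewrite ?plus_IZR; lra.
  - intros y. unfold phi2. pose proof (speed_bounds (g y)).
    apply Rdiv_lt_0_compat; [apply Rdiv_lt_0_compat|]; lra.
Qed.

Theorem theorem3p1 :
  exists (p : R) (phi1 phi2 : R -> R),
    admissible_solution p phi1 phi2 /\
    (forall (q : R) (psi1 psi2 : R -> R),
       admissible_solution q psi1 psi2 ->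
       q = p /\ (forall y : R, psi1 y = phi1 y /\ psi2 y = phi2 y)) /\
    p = sqrt (3 / 8).
Proof.
  destruct admissible_solution_exists as (phi1 & phi2 & Hphi).
  exists (sqrt (3 / 8)), phi1, phi2.
  split; [exact Hphi|]. split; [|reflexivity].
  intros q psi1 psi2 Hpsi.
  pose proof (admissible_initial_value _ _ _ Hpsi) as ->.
  split; [reflexivity|].
  destruct Hphi as (Hp & Hphi & _). destruct Hpsi as (_ & Hpsi & _).
  pose proof (manakov_unique _ _ _ _ _ _ _ _ (ivp_manakov _ _ _ Hpsi)
    (ivp_manakov _ _ _ Hphi) (ivp_bounded _ _ _ Hp Hpsi) (ivp_bounded _ _ _ Hp Hphi))
    as U.
  destruct Hphi as (_ & _ & _ & _ & A1 & A2 & A3 & A4).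
  destruct Hpsi as (_ & _ & _ & _ & B1 & B2 & B3 & B4).
  intros y. destruct (U ltac:(congruence) ltac:(congruence) ltac:(cbv beta; congruence)
    ltac:(cbv beta; congruence) y) as [E1 E2].
  split; [exact E1|lra].
Qed.
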